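(* Let $M$ be a finite subset of a group $G$, let $A$ be a finite alphabet (a finite set), and let $S=A^{A^M}$. Let $s\in S^G$ be asymptotic to a constant configuration $c\in S^G$, and suppose that $\sigma_s\colon A^G\to A^G$ is injective. Then $\sigma_s$ is stably invertible in each of the following cases: (i) $G$ is an amenable group; (ii) $G$ is a sofic group and $\sigma_c$ is injective.
   Context: Sofic group (standard notion): $G$ is sofic if for every finite $K\subset G$ and every $\varepsilon>0$ there exist $n\ge 1$ and a map $\varphi\colon G\to \mathrm{Sym}(n)$ with $d_H(\varphi(gh),\varphi(g)\varphi(h))\le\varepsilon$ for all $g,h\in K$ and $d_H(\varphi(g),\varphi(h))\ge 1-\varepsilon$ for all distinct $g,h\in K$, where $d_H$ is the normalized Hamming distance. For a set $B$, $B^G$ is the set of maps (configurations) $G\to B$, with the prodiscrete topology (product of discrete topologies) and the shift action $(gx)(h)=x(g^{-1}h)$ for $g,h\in G$, $x\in B^G$. For $x\in B^G$, $\Sigma(x)=\overline{\{gx: g\in G\}}\subset B^G$. Two configurations $x,y\in B^G$ are asymptotic if $x|_{G\setminus E}=y|_{G\setminus E}$ for some finite $E\subset G$. $S=A^{A^M}$ is the set of all maps $A^M\to A$. For $s\in S^G$, the non-uniform cellular automaton (NUCA) $\sigma_s\colon A^G\to A^G$ is defined by $\sigma_s(x)(g)=s(g)\big((g^{-1}x)|_M\big)$ for $x\in A^G$, $g\in G$. $\sigma_s$ is stably invertible if there exist a finite set $N\subset G$ and $t\in T^G$, where $T=A^{A^N}$, such that for every $p\in\Sigma(s)$ there is some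 $q\in\Sigma(t)$ with $\sigma_p\circ\sigma_q=\sigma_q\circ\sigma_p=\mathrm{Id}$. *)

(* Defs.v *)
From HB Require Import structures.
From mathcomp Require Import all_boot all_order all_algebra all_fingroup finmap.
From mathcomp Require Import all_classical all_reals topology.

Set Implicit Arguments.
Unset Strict Implicit.
Unset Printing Implicit Defensive.

Import Order.TTheory GRing.Theory Num.Theory.

Local Open Scope fset_scope.
Local Open Scope ring_scope.

(* The parameter R is the field of real numbers; it only serves to express
   the bounds in epsilon. *)

Definition hamming (R : realType) (n : nat) (u v : 'I_n -> 'I_n) : R :=
  #|[set i | u i != v i]|%:R / n%:R.

(* The permutations are composed as functions because MathComp's product of
   permutations is in the opposite order: (u * v)%g = v \o u. *)
Definition sofic (R : realType) (G : groupType) : Prop :=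
  forall (K : {fset G}) (eps : R), 0 < eps ->
  exists n : nat, (1 <= n)%N /\
  exists phi : G -> {perm 'I_n},
    (forall g h, g \in K -> h \in K ->
       hamming R (phi (g * h)%g) (phi g \o phi h) <= eps) /\
    (forall g h, g \in K -> h \in K -> g != h ->
       1 - eps <= hamming R (phi g) (phi h)).

(* Folner's condition. *)
Definition amenable (R : realType) (G : groupType) : Prop :=
  forall (K : {fset G}) (eps : R), 0 < eps ->
  exists F : {fset G}, F != fset0 /\
    #|` [fset (k * f)%g | k in K, f in F] `\` F|%:R <= eps * #|` F|%:R.

Section Configurations.
Context {G : groupType}.

Definition shift {B : Type} (g : G) (x : G -> B) : G -> B :=
  fun h => x (g^-1 * h)%g.

Definition orbit_closure {B : choiceType} (x : G -> B) : set (G -> B) :=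
  closure (range (fun g => shift g x) : set {ptws G -> discrete_topology B}).

Definition asymptotic {B : Type} (x y : G -> B) : Prop :=
  exists E : {fset G}, forall g, g \notin E -> x g = y g.

End Configurations.

(* The set A^(A^M) of local rules with memory M. *)
Notation local_rule M A := {ffun {ffun M -> A} -> A}.

Definition restrict {G : groupType} {A : finType} (M : {fset G}) (x : G -> A) :
  {ffun M -> A} := [ffun m => x (val m)].

Definition nuca {G : groupType} {A : finType} {M : {fset G}}
  (s : G -> local_rule M A) (x : G -> A) : G -> A :=
  fun g => s g (restrict M (shift g^-1%g x)).

Definition stably_invertible {G : groupType} {A : finType} {M : {fset G}}
  (s : G -> local_rule M A) : Prop :=
  exists (N : {fset G}) (t : G -> local_rule N A),
    forall p, orbit_closure s p ->
    exists q, orbit_closure t q /\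
      nuca p \o nuca q = id /\ nuca q \o nuca p = id.

(* Main.v *)
Require Import Defs.
From mathcomp Require Import all_boot all_order all_algebra all_fingroup finmap.
From mathcomp Require Import all_classical all_reals topology.
From mathcomp Require Import zify.

(** Let E be the finite set outside which s agrees with c. Everything reduces
    to one fact: sigma_c is surjective.

    Suppose it is. Fix p and let e range over the patterns on E; write p_e for p
    overwritten by e on E, and pick x_e with sigma_c(x_e) = p_e. Outside E the
    image sigma_s(x_e) equals p, so sigma_s(x_e) = p_(theta(e)) for some map
    theta of the finite set A^E to itself. As sigma_s is injective, so is theta;
    hence theta is onto, every p is attained by sigma_s, and two preimages
    of p under sigma_c must both be among the x_e, hence equal
    (finite_perturbation_bijective). So sigma_s and sigma_c are both bijective.
    By compactness of the configuration space, x(g) depends only on the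
    restriction of sigma_c(x) to a window gN, with N independent of g because
    sigma_c commutes with shifts. Wherever the window avoids E the same recipe
    inverts sigma_s; enlarging N takes care of the finitely many other g. This
    gives sigma_s^-1 = sigma_t with t asymptotic to a constant d
    (nuca_inverse). Finally a point of the orbit closure of s is either a
    translate of s, inverted by the same translate of t, or, when G is infinite,
    the constant c, inverted by d (orbit_closure_perturbation, far_cancel).

    Surjectivity of sigma_c is where the group enters, by a counting argument
    (injective_not_avoiding). If p is not in the image, compactness yields a
    finite K such that no image agrees with p on K, and then no image contains
    any translate of that forbidden pattern. On a finite model V of the group, with
    q letters, the images then miss a pattern on each of many disjoint blocks and
    hence are exponentially fewer than q^|V|, while an injectivity
    property forces at least q^|D| of them for a subset D that is almost all of V.
    - In the sofic case V is {0, ..., n-1} with the approximate action of G, and D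
      is the set of points where this action is faithful to G on a large finite
      set. Injectivity of sigma_c means that z(v) is recovered from the image near
      v, so configurations supported in D have distinct images. This is the
      theorem of Gromov and Weiss (sofic_surjunctive).
    - In the amenable case V is a slight enlargement of a Folner set D, and it
      is enough that sigma_c separates any two configurations that differ at finitely
      many places (amenable_preinjective_surjective, due to Ceccherini-Silberstein,
      Machi and Scarabotti). When G is infinite, two such configurations can
      be translated far away from E, where sigma_s and sigma_c agree, so
      injectivity of sigma_s suffices (constant_preinjective). When G is finite,
      sigma_s is an injective self-map of a finite set, and the first argument
      applies with the identity map in place of sigma_c. *)

Set Implicit Arguments.
Unset Strict Implicit.
Unset Printing Implicit Defensive.

Import Order.TTheory GRing.Theory Num.Theory.

Local Open Scope fset_scope.
Local Open Scope group_scope.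

(** * The prodiscrete topology *)

Section Prodiscrete.
Local Open Scope classical_set_scope.
Context {G : groupType}.
Implicit Types (E F : {fset G}).

Lemma nbhs_agree_on (B : choiceType) (x : G -> B) E :
  nbhs (x : {ptws G -> discrete_topology B}) [set y | {in E, x =1 y}].
Proof.
have nx_filter : Filter (nbhs (x : {ptws G -> discrete_topology B})).
  exact: nbhs_filter.
suff H (r : seq G) : nbhs (x : {ptws G -> discrete_topology B})
    [set y | {in r, x =1 y}] by exact: H.
elim: r => [|g r IH]; first by apply: filterS filterT => y _ z; rewrite in_nil.
have ng : nbhs (x : {ptws G -> discrete_topology B})
    (proj g @^-1` [set x g : discrete_topology B]).
  by apply: proj_continuous; exact: discrete_set1.
apply: filterS (filterI ng IH) => y [/= yg yr] z.
by rewrite inE => /predU1P[->|/yr//]; rewrite -[LHS]yg.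
Qed.

(** Cylinders over finite sets form a neighbourhood base of the prodiscrete
    topology; this turns orbit closures into a combinatorial condition. *)
Lemma orbit_closureP (B : choiceType) (x p : G -> B) :
  orbit_closure x p <-> forall F, exists g, {in F, p =1 shift g x}.
Proof.
split=> [cl F|agree].
  have [_ [[g _ <-] /= gF]] := cl _ (nbhs_agree_on p F).
  by exists g => h hF; rewrite gF.
rewrite /orbit_closure closureEcvg /=.
pose base F := [set y : {ptws G -> discrete_topology B} |
  {in F, p =1 y} /\ exists g, shift g x = y].
have base_filter : Filter (filter_from setT base).
  apply: filter_from_filter => [|E F _ _]; first by exists fset0.
  exists (E `|` F)%fset => // y [py ry]; split; split=> // h hE; apply: py;
    by rewrite inE hE ?orbT.
have base_proper : ProperFilter (filter_from setT base).
  apply: filter_from_proper => F _; have [g gF] := agree F.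
  by exists (shift g x); split => //; exists g.
exists (filter_from setT base) => //; split; last first.
  by move=> U rangeU; exists fset0 => // y [_ [g <-]]; apply: rangeU; exists g.
apply/(@pointwise_cvgP (discrete_topology G) (discrete_topology B)) => g.
apply/discrete_cvg; exists [fset g] => // y [/= py _].
by rewrite -py ?inE.
Qed.

(** Tychonoff for configurations, in the form used below: a family indexed by
    the finite subsets of G has a cluster point along the filter of larger and
    larger finite subsets. Compactness arguments then need no topology: take for
    xs F a configuration that satisfies the constraints inside F. *)
Lemma fset_compactness (B : finType) (xs : {fset G} -> G -> B) :
  exists x : G -> B, forall E, exists2 F, (E `<=` F)%fset & {in E, x =1 xs F}.
Proof.
pose base E := [set xs F | F in [set F | (E `<=` F)%fset]].
have base_filter : Filter (filter_from setT base).
  apply: filter_from_filter => [|E F _ _]; first by exists fset0.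
  exists (E `|` F)%fset => // _ [D /= EFD <-].
  by split; exists D => //=; apply: fsubset_trans EFD;
    [exact: fsubsetUl | exact: fsubsetUr].
have base_proper : ProperFilter (filter_from setT base).
  by apply: filter_from_proper => E _; exists (xs E), E => /=.
have compact_all : compact
    [set x : {ptws G -> discrete_topology B} | forall g, setT (x g)].
  apply: (@tychonoff G (fun=> discrete_topology B) (fun=> setT)) => _.
  apply: finite_compact; exact: (@finite_finset B setT).
have [|x [_ clx]] := compact_all _ base_proper.
  by apply: filterS filterT.
exists x => E.
have [|y [[F /= EF <-] xF]] := clx (base E) _ _ (nbhs_agree_on x E).
  by exists E.
by exists F.
Qed.

End Prodiscrete.

(** * Shift equivariance, locality and compactness *)

Section Nuca.
Context {G : groupType}.

Lemma shift1 (B : Type) (x : G -> B) : shift 1 x = x.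
Proof. by apply/funext => h; rewrite /shift invg1 mul1g. Qed.

Lemma shiftM (B : Type) (g h : G) (x : G -> B) :
  shift g (shift h x) = shift (g * h) x.
Proof. by apply/funext => k; rewrite /shift invMg mulgA. Qed.

Lemma shiftK (B : Type) (g : G) : cancel (@shift G B g) (shift g^-1).
Proof. by move=> x; rewrite shiftM mulVg shift1. Qed.

Lemma shiftVK (B : Type) (g : G) : cancel (@shift G B g^-1) (shift g).
Proof. by move=> x; rewrite shiftM mulgV shift1. Qed.

Lemma shiftVE (B : Type) (g h : G) (x : G -> B) : shift g^-1 x h = x (g * h).
Proof. by rewrite /shift invgK. Qed.

Context {A : finType}.

Lemma restrict_eq (N : {fset G}) (x y : G -> A) :
  {in N, x =1 y} -> Defs.restrict N x = Defs.restrict N y.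
Proof. by move=> xy; apply/ffunP => m; rewrite !ffunE xy ?(valP m). Qed.

Context {M : {fset G}}.
Implicit Types (s : G -> local_rule M A) (c : local_rule M A) (x y : G -> A).

Lemma nuca_local s s' x y g h : s g = s' h ->
  (forall m, m \in M -> x (g * m) = y (h * m)) -> nuca s x g = nuca s' y h.
Proof.
rewrite /nuca => -> xy; congr (s' h _); apply: restrict_eq => m mM.
by rewrite !shiftVE xy.
Qed.

Lemma nuca_shift s x g : nuca (shift g s) (shift g x) = shift g (nuca s x).
Proof.
apply/funext => h; apply: nuca_local => // m _.
by rewrite /shift mulgA.
Qed.

Lemma nuca_shift_inj s g : injective (nuca s) -> injective (nuca (shift g s)).
Proof.
move=> inj_s x y; rewrite -[x](shiftVK g) -[y](shiftVK g) !nuca_shift.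
by move=> /(can_inj (shiftK g)) /inj_s ->.
Qed.

(** The image of a cellular automaton is closed, so a configuration outside it
    is separated from it by a cylinder. *)
Lemma forbidden_pattern s p : (forall x, nuca s x <> p) ->
  exists K : {fset G}, forall x, exists2 k, k \in K & nuca s x k != p k.
Proof.
move=> np; apply: contrapT => nK.
have approx (K : {fset G}) : {x | {in K, nuca s x =1 p}}.
  apply: cid; apply: contrapT => nx; apply: nK; exists K => x; apply: contrapT => nk.
  apply: nx; exists x => k kK; apply: contrapT => /eqP pk; apply: nk.
  by exists k.
have [x xlim] := fset_compactness (fun K => sval (approx K)).
apply: (np x); apply/funext => g.
have [F EF xF] := xlim (g |` [fset g * m | m in M]).
rewrite -[p g](svalP (approx F)); last by rewrite (fsubsetP EF) ?fset1U1.
apply: nuca_local => // m mM; apply: xF.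
by rewrite fset1Ur //; apply/imfsetP; exists m.
Qed.

Definition determines s (g : G) (N : {fset G}) := forall x y,
  (forall n, n \in N -> nuca s x (g * n) = nuca s y (g * n)) -> x g = y g.

Lemma determines_sub s g (N N' : {fset G}) :
  (N `<=` N') -> determines s g N -> determines s g N'.
Proof.
by move=> NN' det x y xy; apply: det => n /(fsubsetP NN'); exact: xy.
Qed.

(** Otherwise there would be pairs with images equal on larger and larger sets
    but distinct values at g; a cluster point of these pairs contradicts
    injectivity. *)
Lemma injective_determines s g : injective (nuca s) ->
  exists N, determines s g N.
Proof.
move=> inj_s; apply: contrapT => nN.
have approx (K : {fset G}) : {xy : (G -> A) * (G -> A) |
    {in K, nuca s xy.1 =1 nuca s xy.2} /\ xy.1 g <> xy.2 g}.
  apply: cid; apply: contrapT => nx; apply: nN; exists [fset g^-1 * k | k in K].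
  move=> x y xy; apply: contrapT => xyg; apply: nx; exists (x, y); split=> // k.
  move=> kK; rewrite /= -[k](mulVKg g) xy //.
  by apply/imfsetP; exists k.
have [xy xylim] :=
  fset_compactness (fun K h => ((sval (approx K)).1 h, (sval (approx K)).2 h)).
have xg : (xy g).1 != (xy g).2.
  have [F gF ->] := xylim [fset g]; last by rewrite inE.
  by apply/eqP; case: (svalP (approx F)).
case/eqP: xg; suff /inj_s eq_xy : nuca s (fst \o xy) = nuca s (snd \o xy).
  by have /(congr1 (fun x => x g)) := eq_xy.
apply/funext => h.
have [F EF xF] := xylim (h |` [fset h * m | m in M]).
have [eqF _] := svalP (approx F).
have hF : h \in F by rewrite (fsubsetP EF) ?fset1U1.
have hm m : m \in M ->
    xy (h * m) = ((sval (approx F)).1 (h * m), (sval (approx F)).2 (h * m)).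
  by move=> mM; rewrite xF // fset1Ur //; apply/imfsetP; exists m.
transitivity (nuca s (sval (approx F)).1 h).
  by apply: nuca_local => // m /hm /= ->.
by rewrite eqF //; apply: nuca_local => // m /hm /= ->.
Qed.

Lemma far_translate (D E : {fset G}) : (forall F : {fset G}, exists g, g \notin F) ->
  exists g, forall h, h \in D -> g * h \notin E.
Proof.
move=> infG; have [g gDE] := infG [fset e * h^-1 | e in E, h in D].
exists g => h hD; apply: contra gDE => ghE.
by apply/imfset2P; exists (g * h) => //; exists h => //; rewrite mulgK.
Qed.

(** Translating s moves its defects away from the finite set where x and y
    differ, so near that set the translated automaton acts as the constant one;
    elsewhere x and y look the same to any local rule. *)
Lemma constant_preinjective s c (E D : {fset G}) x y :
  (forall F : {fset G}, exists g, g \notin F) ->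
  (forall g, g \notin E -> s g = c) -> injective (nuca s) ->
  (forall g, g \notin D -> x g = y g) ->
  nuca (fun=> c) x = nuca (fun=> c) y -> x = y.
Proof.
move=> infG sc inj_s xyD cxy.
have [g gE] := far_translate [fset d * m^-1 | d in D, m in M] E infG.
apply: (nuca_shift_inj (g := g^-1) inj_s); apply/funext => h.
have [hD|hD] := boolP (h \in [fset d * m^-1 | d in D, m in M]).
  have /(congr1 (fun z => z h)) /= := cxy.
  by rewrite /nuca shiftVE sc // gE.
apply: nuca_local => // m mM; apply: xyD; apply: contra hD => hmD.
by apply/imfset2P; exists (h * m) => //; exists m => //; rewrite mulgK.
Qed.

End Nuca.

(** * Counting configurations that avoid patterns on disjoint blocks *)

Section Counting.
(* The set operations of this section are those of finite types. *)
Import mathcomp.boot.fintype mathcomp.boot.finset.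
Local Open Scope bool_scope.
Local Open Scope nat_scope.

(** By Bernoulli's inequality. A block of n = q^k patterns that loses one of them
    divides the number of configurations by n/(n-1); l such blocks outweigh one
    more free cell, which multiplies it by q. *)
Lemma exists_dominating_power q n : 0 < n ->
  exists2 l, 0 < l & n.-1 ^ l * q < n ^ l.
Proof.
case: n => // n _ /=.
have bernoulli l : n ^ l * (n + l) <= n.+1 ^ l * n.
  elim: l => [|l IH]; first by rewrite addn0.
  have le_n : n * (n + l.+1) <= n.+1 * (n + l) by lia.
  rewrite !expnS -[X in _ <= X]mulnA; apply: leq_trans (leq_mul (leqnn n.+1) IH).
  by rewrite mulnAC [X in _ <= X]mulnCA [X in _ <= X]mulnC leq_mul2r le_n orbT.
exists (n * q).+1 => //; case: n bernoulli => [|n] bernoulli.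
  by rewrite exp0n // exp1n.
rewrite -(ltn_pmul2r (ltn0Sn n)); apply: leq_trans (bernoulli _).
by rewrite -mulnA ltn_pmul2l ?expn_gt0 //; lia.
Qed.

Section Blocks.
Context {V A : finType}.

(** Adding a block i to J: overwriting a configuration by the forbidden pattern
    on b i keeps it among those avoiding J, since the blocks are disjoint, and
    forgets at most q^k possibilities. So at least a fraction 1/q^k of the
    configurations avoiding J fail to avoid i :: J. *)
Lemma card_avoiding (I : eqType) (J : seq I) (b : I -> {set V}) (f : I -> V -> A) k :
  0 < #|A| -> uniq J ->
  {in J &, forall i j, i != j -> [disjoint b i & b j]} ->
  {in J, forall i, #|b i| <= k} ->
  #|[set z : {ffun V -> A} | all (fun i => [exists u in b i, z u != f i u]) J]|
    * (#|A| ^ k) ^ size J <= (#|A| ^ k).-1 ^ size J * #|A| ^ #|V|.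
Proof.
move=> A_gt0; elim: J => [|i J IH] /=.
  by move=> _ _ _; rewrite muln1 mul1n (leq_trans (max_card _)) // card_ffun.
move=> /andP[iJ uJ] dis kb; set Q := #|A| ^ k.
have subJ : {subset J <= i :: J} by move=> j jJ; rewrite inE jJ orbT.
have {}IH := IH uJ (sub_in2 subJ dis)
  (sub_in1 subJ kb).
set X := [set z : {ffun V -> A} | all _ J] in IH *.
set X' := [set z : {ffun V -> A} | _ && _].
have sub_X'X : X' \subset X by apply/subsetP => z; rewrite !inE => /andP[].
pose overwrite (z : {ffun V -> A}) := [ffun u => if u \in b i then f i u else z u].
have [a0 _] := card_gt0P A_gt0.
pose inside (z : {ffun V -> A}) := [ffun u => if u \in b i then z u else a0].
(* A configuration is recovered from its overwritten version together with what
   was inside the block. *)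
have card_X : #|X| <= #|X :\: X'| * Q.
  pose Y := [set z in pffun_on a0 (b i) predT].
  have card_Y : #|Y| <= Q.
    rewrite cardsE card_pffun_on leq_pexp2l // kb ?mem_head //.
  apply: leq_trans (leq_mul (leqnn _) card_Y); rewrite -cardsX.
  rewrite -(card_in_imset (f := fun z => (overwrite z, inside z)) (D := mem X)).
    apply/subset_leq_card/subsetP => _ /imsetP[z zX ->]; rewrite !inE /=.
    apply/andP; split; last first.
      apply/pffun_onP; split=> // ; apply/fintype.subsetP => u; rewrite inE ffunE.
      by case: ifP => //; rewrite eqxx.
    rewrite negb_and; apply/andP; split.
      apply/orP; left; apply/existsPn => u; rewrite ffunE.
      by case: ifP => //=; rewrite eqxx.
    apply/allP => j jJ; move: zX; rewrite inE => /allP/(_ j jJ)/existsP[u /andP[ub zu]].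
    apply/existsP; exists u; rewrite ub ffunE ifN //=.
    have ij : j != i by apply: contraNneq iJ => <-.
    have [jiJ iiJ] : j \in i :: J /\ i \in i :: J by rewrite !inE jJ eqxx orbT.
    by rewrite (disjointFr (dis j i jiJ iiJ ij) ub).
  move=> z z' _ _ [/ffunP eqo /ffunP eqi]; apply/ffunP => u.
  by move: (eqo u) (eqi u); rewrite !ffunE; case: ifP.
have Q_gt0 : 0 < Q by rewrite expn_gt0 A_gt0.
have step : #|X'| * Q <= Q.-1 * #|X|.
  have := cardsID X' X; rewrite (setIidPr sub_X'X); case: Q Q_gt0 card_X => //=; nia.
rewrite !expnS mulnA (leq_trans (leq_mul step (leqnn _))) //.
by rewrite -!mulnA leq_mul2l IH orbT.
Qed.

Lemma card_bigcup_le (T : finType) (B : {set T}) (F : T -> {set V}) m :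
  {in B, forall i, #|F i| <= m} -> #|\bigcup_(i in B) F i| <= #|B| * m.
Proof.
move=> Fm; rewrite -sum_nat_const.
elim/big_rec2: _ => [|i n U iB Un]; first by rewrite cards0.
by rewrite (leq_trans (leq_card_setU _ _)) // leq_add // Fm.
Qed.

(** A maximal disjoint subfamily J meets every block; a member of J has at most
    k cells and each cell lies in at most k blocks. *)
Lemma disjoint_subfamily (D : {set V}) (b : V -> {set V}) k :
  {in D, forall v, 0 < #|b v| <= k} ->
  (forall u, #|[set v in D | u \in b v]| <= k) ->
  exists J : {set V}, [/\ J \subset D,
    {in J &, forall i j, i != j -> [disjoint b i & b j]} & #|D| <= #|J| * (k * k)].
Proof.
move=> kb kd.
pose P (J : {set V}) := (J \subset D) &&
  [forall i in J, forall j in J, (i != j) ==> [disjoint b i & b j]].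
have [|J maxJ] := @ex_maxset _ P.
  exists set0; rewrite /P sub0set /=.
  by apply/'forall_implyP => i; rewrite inE.
have /andP[JD /'forall_implyP disJ] := maxsetp maxJ.
have {}disJ : {in J &, forall i j, i != j -> [disjoint b i & b j]}.
  by move=> i j iJ jJ; have /'forall_implyP/(_ j jJ)/implyP := disJ i iJ.
exists J; split=> //.
have cover : D \subset \bigcup_(j in J) \bigcup_(u in b j) [set v in D | u \in b v].
  apply/subsetP => v vD; have /andP[bv _] := kb v vD.
  have [u ub] := card_gt0P bv.
  have [vJ|vJ] := boolP (v \in J).
    by apply/bigcupP; exists v => //; apply/bigcupP; exists u => //; rewrite inE vD.
  have [/existsP[j /andP[jJ ]]|no] :=
      boolP [exists j in J, ~~ [disjoint b j & b v]].
    rewrite -setI_eq0 => /set0Pn[w /setIP[wj wv]].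
    by apply/bigcupP; exists j => //; apply/bigcupP; exists w => //; rewrite inE vD.
  have disv j : j \in J -> [disjoint b j & b v].
    by move=> jJ; have := existsPn no j; rewrite jJ negbK.
  have PvJ : P (v |: J).
    rewrite /P subUset sub1set vD JD /=.
    apply/'forall_implyP => i iJ; apply/'forall_implyP => j jJ; apply/implyP => ij.
    case/setU1P: iJ ij => [->|iJ]; case/setU1P: jJ => [->|jJ]; rewrite ?eqxx //.
    - by rewrite disjoint_sym disv.
    - by rewrite disv.
    - exact: disJ.
  have /setP/(_ v) := maxsetsup maxJ PvJ (subsetUr _ _).
  by rewrite setU11 (negPf vJ).
apply: leq_trans (subset_leq_card cover) _.
apply: card_bigcup_le => j jJ; have /andP[_ bj] := kb j (subsetP JD j jJ).
by apply: leq_trans (card_bigcup_le (m := k) _) _ => [u _|];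
  rewrite ?leq_mul2r ?bj ?orbT.
Qed.


End Blocks.

(** The common core of the two surjectivity theorems. T is a map that is
    injective on the configurations equal to a0 outside D, so its image has at
    least q^|D| elements; but the image avoids a pattern on the block b v of every
    v in D, which by card_avoiding is too few once D misses only a small
    proportion of V. The constant L quantifies this and depends only on
    the alphabet and on the block size. *)
Lemma injective_not_avoiding (q k : nat) : exists2 L : nat, 0 < L &
  forall (V A : finType) (T : {ffun V -> A} -> {ffun V -> A}) (a0 : A)
    (D : {set V}) (b : V -> {set V}) (f : V -> V -> A),
  #|A| = q -> (0 < #|D|) -> (L * #|~: D| <= #|D|) ->
  {in D, forall v, 0 < #|b v| <= k} ->
  (forall u, #|[set v in D | u \in b v]| <= k) ->
  {in pffun_on a0 (mem D) predT &, injective T} ->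
  ~ (forall v z, v \in D -> exists2 u, u \in b v & T z u != f v u).
Proof.
have [->|q_gt0] := posnP q.
  exists 1 => // V A T a0 D b f A0; have := max_card (pred1 a0).
  by rewrite card1 A0.
have Q_gt0 : (0 < q ^ k) by rewrite expn_gt0 q_gt0.
have [l l_gt0 dom] := exists_dominating_power q Q_gt0.
(* At least |D| / k^2 blocks are disjoint, and every l of them pay for one
   cell outside D. *)
exists (l * (k * k)).+1 => // V A T a0 D b f Aq D_gt0 LD kb kd injT avoid.
have [J [JD disJ cardJ]] := disjoint_subfamily kb kd.
have memJ v : (v \in enum J) = (v \in J) by rewrite mem_enum.
have countJ := @card_avoiding V A V (enum J) b f k.
rewrite Aq -cardE enum_uniq in countJ.
set X := [set z | _] in countJ.
have {}countJ : #|X| * (q ^ k) ^ #|J| <= (q ^ k).-1 ^ #|J| * q ^ #|V|.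
  apply: countJ => // [i j|i]; rewrite !memJ; first exact: disJ.
  by move=> /(subsetP JD) iD; have /andP[] := kb i iD.
have leX : q ^ #|D| <= #|X|.
  rewrite -Aq -(card_pffun_on a0 (mem D) predT) -(card_in_imset injT).
  apply/subset_leq_card/subsetP => _ /imsetP[z _ ->]; rewrite inE.
  apply/allP => v; rewrite memJ => /(subsetP JD) vD.
  by have [u ub uf] := avoid v z vD; apply/existsP; exists u; rewrite ub.
have {X leX}countJ : (q ^ k) ^ #|J| <= (q ^ k).-1 ^ #|J| * q ^ #|~: D|.
  rewrite -(leq_pmul2l (m := q ^ #|D|)) ?expn_gt0 ?q_gt0 // mulnCA -expnD cardsC.
  by apply: leq_trans countJ; rewrite leq_mul2r leX orbT.
have k_gt0 : 0 < k * k.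
  rewrite lt0n; apply: contraTneq D_gt0 => k0.
  by move: cardJ; rewrite k0 muln0 -leqNgt.
have J_gt0 : 0 < #|J|.
  by rewrite lt0n; apply: contraTneq cardJ => ->; rewrite mul0n -ltnNge.
have le_J : l * #|~: D| <= #|J|.
  rewrite -(leq_pmul2r k_gt0); apply: leq_trans (leq_trans LD cardJ).
  by rewrite mulSn -mulnAC leq_addl.
have Q1 : (q ^ k).-1 < q ^ k by rewrite prednK.
suff : (q ^ k).-1 ^ #|J| * q ^ #|~: D| < (q ^ k) ^ #|J|.
  by rewrite ltnNge countJ.
have [D0|Dn0] := posnP #|~: D|; first by rewrite D0 muln1 ltn_exp2r.
rewrite -(subnKC le_J) !expnD mulnAC !(expnM _ l) -expnMn.
apply: (@leq_ltn_trans
  (((q ^ k).-1 ^ l * q) ^ #|~: D| * (q ^ k) ^ (#|J| - l * #|~: D|))).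
  rewrite leq_mul ?leqnn //; case: (#|J| - _) => [|r]; first by rewrite !expn0.
  by rewrite leq_exp2r ?leq_pred.
by rewrite ltn_pmul2r ?ltn_exp2r // expn_gt0 Q_gt0.
Qed.

End Counting.

(** * Finite models of amenable and sofic groups *)

Section Approximation.
Local Open Scope ring_scope.

(** Cellular automata read their argument at g * m, so almost invariance under
    right translations is wanted; inversion exchanges the two sides. *)
Lemma folner_right (R : realType) (G : groupType) : amenable R G ->
  forall (K : {fset G}) (L : nat), exists F : {fset G}, F != fset0 /\
    (L * #|` ([fset (f * k)%g | f in F, k in K] `\` F)%fset | <= #|` F|)%N.
Proof.
move=> amG K L; pose eps : R := L.+1%:R^-1.
have eps_gt0 : 0 < eps by rewrite invr_gt0 ltr0n.
have [F [F0 le_F]] := amG [fset k^-1%g | k in K]%fset eps eps_gt0.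
have card_inv (X : {fset G}) : #|` [fset x^-1%g | x in X]%fset| = #|` X|.
  by rewrite card_imfset //=; exact: invg_inj.
exists [fset f^-1%g | f in F]%fset; split.
  have /fset0Pn[f fF] := F0; apply/fset0Pn; exists f^-1%g.
  by apply/imfsetP; exists f.
rewrite card_inv.
have {le_F} : (L.+1 * #|` [fset (k * f)%g | k in [fset k^-1%g | k in K], f in F] `\` F|
    <= #|` F|)%N.
  by move: le_F; rewrite ler_pdivlMl ?ltr0n // -natrM ler_nat.
apply: leq_trans; rewrite leq_mul // -[X in (_ <= X)%N]card_inv.
apply/fsubset_leq_card/fsubsetP => _
  /fsetDP[/imfset2P[_ /imfsetP[f /= fF ->] [k kK ->]] nF].
apply/imfsetP; exists (k^-1 * f)%g; rewrite ?invMg ?invgK //=.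
rewrite inE; apply/andP; split.
  by apply: contra nF => kfF; apply/imfsetP; exists (k^-1 * f)%g; rewrite ?invMg ?invgK.
by apply/imfset2P; exists k^-1%g; [apply/imfsetP; exists k | exists f].
Qed.

(** The averages in the definition of soficity become a single good set D: for
    each of the finitely many pairs in W only a small proportion of points
    misbehaves, and D collects the points that misbehave for no pair. *)
Lemma sofic_model (R : realType) (G : groupType) : sofic R G ->
  forall (W : {fset G}) (L : nat), (0 < L)%N ->
  exists (n : nat) (phi : G -> {perm 'I_n}) (D : {set 'I_n}),
    [/\ (0 < #|D|)%N, (L * #|finset.setC D| <= #|D|)%N &
     {in D, forall v, {in W &, forall g h,
        phi (g * h)%g v = phi g (phi h v) /\ (g != h -> phi g v != phi h v)}}].
Proof.
move=> sofG W L L_gt0.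
(* With at most |W|^2 pairs and two conditions on each, defects of density
   1 / (2 C) leave at most n / (L + 1) bad points. *)
pose C := ((#|` W| * #|` W|).+1 * L.+1)%N.
pose eps : R := (2 * C)%:R^-1.
have eps_gt0 : 0 < eps by rewrite invr_gt0 ltr0n.
have [n [n_gt0 [phi [phiM phiI]]]] := sofG W eps eps_gt0.
have nR_gt0 : 0 < n%:R :> R by rewrite ltr0n.
pose badM g h := [set v | phi (g * h)%g v != phi g (phi h v)].
pose badI g h := [set v | (g != h) && (phi g v == phi h v)].
pose bad (gh : W * W) :=
  finset.setU (badM (val gh.1) (val gh.2)) (badI (val gh.1) (val gh.2)).
have le_badM g h : g \in W -> h \in W -> (#|badM g h| * (2 * C) <= n)%N.
  move=> gW hW; have := phiM g h gW hW; rewrite /hamming ler_pdivrMr //.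
  by rewrite mulrC ler_pdivlMr ?ltr0n // -natrM ler_nat.
have le_badI g h : g \in W -> h \in W -> (#|badI g h| * (2 * C) <= n)%N.
  move=> gW hW; have [->|gh] := eqVneq g h.
    have -> : badI h h = finset.set0.
      by apply/finset.setP => v; rewrite !finset.inE eqxx.
    by rewrite finset.cards0.
  have := phiI g h gW hW gh; rewrite /hamming ler_pdivlMr // mulrBl mul1r lerBlDl.
  have -> : [set v | phi g v != phi h v]%SET = finset.setC (badI g h).
    by apply/finset.setP => v; rewrite !finset.inE gh.
  rewrite -[X in X%:R <= _](card_ord n) -(finset.cardsC (badI g h)) natrD lerD2r.
  by rewrite ler_pdivlMl ?ltr0n // -natrM ler_nat mulnC.
pose D := finset.setC (\bigcup_(gh in finset.setT) bad gh)%SET.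
have le_D : (#|finset.setC D| * L.+1 <= n)%N.
  rewrite finset.setCK.
  have le_bad : {in finset.setT, forall gh, #|bad gh| <= n %/ C}%N.
    move=> [g h] _; rewrite leq_divRL //.
    rewrite (leq_trans (leq_mul (leq_card_setU _ _) (leqnn _))) //.
    have := le_badM _ _ (valP g) (valP h); have := le_badI _ _ (valP g) (valP h).
    simpl; lia.
  have := card_bigcup_le le_bad.
  rewrite finset.cardsT card_prod -!cardfE => le_cup.
  apply: leq_trans (leq_mul le_cup (leqnn _)) _.
  apply: leq_trans (leq_divM n C); rewrite mulnAC [X in (_ <= X)%N]mulnC.
  by rewrite leq_mul2r leq_mul2r leqnSn !orbT.
have cardD := cardsC D; rewrite card_ord in cardD.
exists n, phi, D; split; [nia | nia | ].
move=> v vD g h gW hW.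
have : v \notin bad ([` gW], [` hW])%fset.
  apply: contraTN vD => vbad; rewrite finset.inE negbK.
  by apply/bigcupP; exists ([` gW], [` hW])%fset.
rewrite !finset.inE /= negb_or negb_and !negbK => /andP[/eqP -> gh]; split=> // neq_gh.
by move: gh; rewrite (negPf neq_gh).
Qed.

End Approximation.

(** * Surjectivity of cellular automata *)

Section Surjunctivity.
Context {G : groupType} {A : finType} {M : {fset G}}.
Implicit Types (c : local_rule M A) (p : G -> A).
Import mathcomp.boot.fintype mathcomp.boot.finset.

Lemma forbidden_pattern1 c p : (forall x, nuca (fun=> c) x <> p) ->
  exists2 K : {fset G}, 1 \in K &
    forall x, exists2 k, k \in K & nuca (fun=> c) x k != p k.
Proof.
move=> /forbidden_pattern[K pK]; exists (1 |` K)%fset; first exact: fset1U1.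
by move=> x; have [k kK ?] := pK x; exists k => //; rewrite fset1Ur.
Qed.

Lemma card_set_seq (V : finType) (r : seq V) : (#|[set u | u \in r]| <= size r)%N.
Proof. by rewrite cardsE card_size. Qed.

(** Gromov-Weiss. The right translate of a point v by g is modelled by
    phi(g^-1)(v). On the model the automaton T computes at v, for good v, the value
    of sigma_c at the pulled back configuration h |-> z(phi(h^-1)(v)), which is
    defined on all of G. Hence the window N recovers z(v) from T z, and T z never
    shows the forbidden pattern around v. *)
Lemma sofic_surjunctive (R : realType) c : sofic R G ->
  injective (nuca (fun=> c)) -> forall p, exists x, nuca (fun=> c) x = p.
Proof.
move=> sofG inj_c p; apply: contrapT => np.
have [|K K1 pK] := @forbidden_pattern1 c p; first by move=> x xp; apply: np; exists x.
have [N detN] := injective_determines 1 inj_c.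
have [L L_gt0 count] := injective_not_avoiding #|A| #|` K|.
pose W := [fset g^-1 | g in (K `|` M `|` N)%fset]%fset.
have memW g : g \in K \/ g \in M \/ g \in N -> g^-1 \in W.
  move=> gKMN; apply/imfsetP; exists g => //; rewrite !in_fsetU.
  by case: gKMN => [|[]] ->; rewrite ?orbT.
have [n [phi [D [D_gt0 LD phiD]]]] := sofic_model sofG W L_gt0.
have phi1 v : v \in D -> phi 1 v = v.
  move=> vD; have W1 : 1 \in W by rewrite -invg1; apply: memW; left.
  by have [] := phiD v vD 1 1 W1 W1; rewrite mul1g => /perm_inj <-.
pose T (z : {ffun 'I_n -> A}) :=
  [ffun v => c [ffun m : M => z (phi (val m)^-1 v)]].
have TE z v g : v \in D -> g \in K \/ g \in M \/ g \in N ->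
    T z (phi g^-1 v) = nuca (fun=> c) (fun h => z (phi h^-1 v)) g.
  move=> vD gKN; rewrite ffunE /nuca; congr (c _); apply/ffunP => m.
  rewrite !ffunE shiftVE invMg.
  have mW : (val m)^-1 \in W by apply: memW; right; left; exact: valP.
  by have [-> _] := phiD v vD _ _ mW (memW g gKN).
pose b v := [set u | u \in [seq phi k^-1 v | k <- K]].
(* The pattern around v at u is p k for the k in K that carries v to u. *)
pose f v u := p (nth 1 K (find (fun k => phi k^-1 v == u) K)).
apply: (count 'I_n A T (p 1) D b f) => //.
- move=> v _; apply/andP; split; last by rewrite (leq_trans (card_set_seq _)) ?size_map.
  by apply/card_gt0P; exists (phi 1^-1 v); rewrite inE map_f.
- move=> u; rewrite -(size_map (fun k => (phi k^-1)^-1 u) K).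
  apply: leq_trans (card_set_seq _); apply/subset_leq_card/subsetP => v.
  rewrite !inE => /andP[_ /mapP[k kK ->]].
  by apply/mapP; exists k; rewrite ?permK.
- move=> z z' /pffun_onP[/fintype.subsetP zD _] /pffun_onP[/fintype.subsetP zD' _] Tzz'.
  apply/ffunP => v; have [vD|vD] := boolP (v \in D); last first.
    have := contra (zD v) vD; have := contra (zD' v) vD.
    by rewrite !inE !negbK => /eqP -> /eqP ->.
  have := detN (fun h => z (phi h^-1 v)) (fun h => z' (phi h^-1 v)).
  rewrite !invg1 phi1 //; apply=> k kN; rewrite mul1g.
  by rewrite -!TE ?Tzz' //; right; right.
- move=> v z vD; have [k kK kp] := pK (fun h => z (phi h^-1 v)).
  exists (phi k^-1 v); first by rewrite inE map_f.
  rewrite TE //; last by left.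
  have has_k : has (fun k' => phi k'^-1 v == phi k^-1 v) K.
    by apply/hasP; exists k.
  have mem_k := mem_nth 1 (etrans (esym (has_find _ _)) has_k).
  have /eqP eq_k := nth_find 1 has_k.
  rewrite /f; set k' := nth _ _ _ in mem_k eq_k *.
  suff -> : k' = k by [].
  apply: invg_inj; apply: contraTeq isT => neq_k.
  have [_ /(_ neq_k)] :=
    phiD v vD _ _ (memW _ (or_introl mem_k)) (memW _ (or_introl kK)).
  by rewrite eq_k eqxx.
Qed.

(** The Garden of Eden theorem, in the direction of Myhill. Configurations on V
    are extended by a constant letter to G. Those supported in F
    have images that differ at most on F M^-1, a subset of V, so restricting
    the images to V loses nothing; and V contains the translates f K with f in F,
    on which the forbidden pattern cannot occur. *)
Lemma amenable_preinjective_surjective (R : realType) c : amenable R G ->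
  (forall (E : {fset G}) x y, (forall g, g \notin E -> x g = y g) ->
     nuca (fun=> c) x = nuca (fun=> c) y -> x = y) ->
  forall p, exists x, nuca (fun=> c) x = p.
Proof.
move=> amG preinj p; apply: contrapT => np.
have [|K K1 pK] := @forbidden_pattern1 c p; first by move=> x xp; apply: np; exists x.
have [L L_gt0 count] := injective_not_avoiding #|A| #|` K|.
pose W := (K `|` [fset m^-1 | m in M])%fset.
have [F [F0 LF]] := folner_right amG W L.
pose V := [fset f * w | f in F, w in W]%fset.
have memV f w : f \in F -> w \in W -> f * w \in V.
  by move=> fF wW; apply/imfset2P; exists f => //; exists w.
have KW k : k \in K -> k \in W by move=> kK; rewrite in_fsetU kK.
have FV f : f \in F -> f \in V by move=> fF; rewrite -[f]mulg1 memV ?KW.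
pose ext (z : {ffun V -> A}) g := if insub g is Some v then z v else p 1.
have extE z (v : V) : ext z (val v) = z v by rewrite /ext valK.
pose T z := [ffun v : V => nuca (fun=> c) (ext z) (val v)].
pose D := [set v : V | val v \in F].
pose b (v : V) := [set u : V | val u \in [seq val v * k | k <- K]].
pose f (v u : V) := p ((val v)^-1 * val u).
have card_val (B : {set V}) (r : seq G) : (forall v, v \in B -> val v \in r) ->
    (#|B| <= size r)%N.
  move=> Br; rewrite cardE -(size_map val); apply: uniq_leq_size.
    by rewrite map_inj_uniq ?enum_uniq //; exact: val_inj.
  by move=> _ /mapP[v + ->]; rewrite mem_enum; exact: Br.
have D_gt0 : (0 < #|D|)%N.
  have /fset0Pn[g gF] := F0; apply/card_gt0P.
  by exists [` FV g gF]%fset; rewrite inE.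
have le_setCD : (#|~: D| <= #|` V `\` F|)%N.
  by apply: card_val => v; rewrite !inE in_fsetD => ->; rewrite (valP v).
have le_FD : (#|` F| <= #|D|)%N.
  rewrite cardE -(size_map val); apply: uniq_leq_size; first exact: fset_uniq.
  move=> g gF; apply/mapP; exists [` FV g gF]%fset => //.
  by rewrite mem_enum inE.
apply: (count V A T (p 1) D b f) => //.
- by apply: leq_trans le_FD; apply: leq_trans LF; rewrite leq_mul2l le_setCD orbT.
- move=> v vD; apply/andP; split.
    apply/card_gt0P; exists v; rewrite inE; apply/mapP; exists 1 => //.
    by rewrite mulg1.
  rewrite -(size_map (fun k => val v * k) K).
  by apply: card_val => u; rewrite inE.
- move=> u; rewrite -(size_map (fun k => val u * k^-1) K).
  apply: card_val => v; rewrite !inE => /andP[_ /mapP[k kK ->]].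
  by apply/mapP; exists k; rewrite ?mulgK.
- move=> z z' /pffun_onP[/fintype.subsetP zD _] /pffun_onP[/fintype.subsetP zD' _] Tzz'.
  have extF g : g \notin F -> ext z g = ext z' g.
    rewrite /ext; case: insubP => // v _ <- vF.
    have vD : v \notin D by rewrite inE.
    have := contra (zD v) vD; have := contra (zD' v) vD.
    by rewrite !inE !negbK => /eqP -> /eqP ->.
  suff /(preinj F _ _ extF) ext_zz' : nuca (fun=> c) (ext z) = nuca (fun=> c) (ext z').
    by apply/ffunP => v; rewrite -!extE ext_zz'.
  apply/funext => g; have [gV|gV] := boolP (g \in V).
    by have /ffunP/(_ [` gV]%fset) := Tzz'; rewrite !ffunE.
  apply: nuca_local => // m mM; apply: extF; apply: contra gV => gmF.
  rewrite -[g](mulgK m) memV // in_fsetU; apply/orP; right.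
  by apply/imfsetP; exists m.
- move=> v z; rewrite inE => vF.
  have [k kK kp] := pK (shift (val v)^-1 (ext z)).
  exists [` memV _ _ vF (KW k kK)]%fset; first by rewrite inE; apply/mapP; exists k.
  rewrite /f /= mulKg ffunE /=; move: kp; congr (_ != _).
  by apply: nuca_local => // m _; rewrite shiftVE mulgA.
Qed.

End Surjunctivity.

(** * Inverses of finite perturbations *)

(** For e in A^E choose X e with Psi (X e) = p overwritten by e on E. Then
    Phi (X e) is p overwritten by Theta e, and Theta is injective because Phi is;
    as A^E is finite, Theta is onto. So p is a value of Phi, and by injectivity of
    Phi the X e are all the preimages under Psi of configurations that agree with p
    outside E. *)
Lemma finite_perturbation_bijective (G : choiceType) (A : finType)
    (E : {fset G}) (Phi Psi : (G -> A) -> (G -> A)) :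
  (forall x g, g \notin E -> Phi x g = Psi x g) ->
  injective Phi -> (forall p, exists x, Psi x = p) ->
  (forall p, exists x, Phi x = p) /\ injective Psi.
Proof.
move=> PhiPsi inj_Phi surj_Psi.
pose splice p (e : {ffun E -> A}) g := if insub g is Some v then e v else p g.
pose inside (x : G -> A) : {ffun E -> A} := [ffun v => x (val v)].
have spliceK p : cancel (splice p) inside.
  by move=> e; apply/ffunP => v; rewrite ffunE /splice valK.
have spliceE p x : (forall g, g \notin E -> x g = p g) -> x = splice p (inside x).
  move=> xp; apply/funext => g; rewrite /splice.
  by case: insubP => [v _ <-|gE]; [rewrite ffunE | rewrite xp].
have preimages p : exists X : {ffun E -> A} -> G -> A,
    (forall e, Psi (X e) = splice p e) /\
    forall e', exists e, Phi (X e) = splice p e'.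
  have [X PsiX] := choice (fun e => surj_Psi (splice p e)).
  exists X; split=> // e'.
  pose Theta e := inside (Phi (X e)).
  have PhiX e : Phi (X e) = splice p (Theta e).
    apply: spliceE => g gE; rewrite PhiPsi // PsiX /splice.
    by case: insubP => [v vE|//]; rewrite vE in gE.
  have inj_Theta : injective Theta.
    move=> e1 e2 eq_Theta; apply: (can_inj (spliceK p)); rewrite -!PsiX.
    by congr Psi; apply: inj_Phi; rewrite !PhiX eq_Theta.
  have [inv_Theta _ ThetaK] := injF_bij inj_Theta.
  by exists (inv_Theta e'); rewrite PhiX ThetaK.
split=> [p|x y].
  have [X [_ PhiX]] := preimages p; have [e Xe] := PhiX (inside p).
  by exists (X e); rewrite Xe -spliceE.
move=> eq_Psi; have [X [PsiX PhiX]] := preimages (Psi x).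
have preim z : Psi z = Psi x -> exists e, X e = z.
  move=> eq_z; have [e Xe] := PhiX (inside (Phi z)).
  exists e; apply: inj_Phi; rewrite Xe -spliceE // => g gE.
  by rewrite PhiPsi // eq_z.
have [e1 X1] := preim x erefl; have [e2 X2] := preim y (esym eq_Psi).
rewrite -X1 -X2; congr X; apply: (can_inj (spliceK (Psi x))).
by rewrite -!PsiX X1 X2.
Qed.

Section Inverse.
Context {G : groupType} {A : finType} {M : {fset G}}.
Implicit Types (s : G -> local_rule M A) (c : local_rule M A).

Lemma determines_constant c g (N : {fset G}) :
  determines (fun=> c) 1 N -> determines (fun=> c) g N.
Proof.
move=> det x y xy; have := det (shift g^-1 x) (shift g^-1 y).
rewrite !shiftVE mulg1; apply=> n nN; rewrite mul1g.
have shift_c z : nuca (fun=> c) (shift g^-1 z) = shift g^-1 (nuca (fun=> c) z).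
  exact: (nuca_shift (fun=> c)).
by rewrite !shift_c !shiftVE xy.
Qed.

(** Far from the defects of s the window of the constant automaton works, and
    the finitely many remaining windows are added to it. *)
Lemma determines_perturbation s c (E N : {fset G}) :
  (forall g, g \notin E -> s g = c) -> injective (nuca s) ->
  determines (fun=> c) 1 N ->
  exists N' : {fset G}, (N `<=` N')%fset /\ forall g, determines s g N'.
Proof.
move=> sc inj_s detN.
have [W detW] := choice (fun g => injective_determines g inj_s).
pose E' := [fset e * n^-1 | e in E, n in N]%fset.
exists (N `|` \bigcup_(g <- E') W g)%fset; split=> [|g]; first exact: fsubsetUl.
have [gE|gE] := boolP (g \in E').
  apply: determines_sub (detW g); apply: fsubset_trans (fsubsetUr _ _).
  exact: bigfcup_sup.
apply: determines_sub (fsubsetUl _ _) _ => x y xy.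
apply: (determines_constant (g := g) detN) => n nN.
have gnE : g * n \notin E.
  apply: contra gE => gnE.
  by apply/imfset2P; exists (g * n) => //; exists n; rewrite ?mulgK.
by have := xy n nN; rewrite /nuca sc.
Qed.

(** The configuration y is only required to agree with the image of x on the
    window: this lets a rule found for the constant automaton be applied to images
    under its perturbation. *)
Definition recovers s g (N : {fset G}) (f : local_rule N A) := forall x y,
  (forall n, n \in N -> y (g * n) = nuca s x (g * n)) ->
  f (Defs.restrict N (shift g^-1 y)) = x g.

(** Patterns that are not seen in the image may be sent anywhere; a
    window containing 1 provides a letter for them, even if A is empty. *)
Lemma determines_recovers s g (N : {fset G}) : 1 \in N -> determines s g N ->
  exists f : local_rule N A, recovers s g f.
Proof.
move=> N1 det.
have value (pi : {ffun N -> A}) : exists a, forall x,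
    (forall n : N, nuca s x (g * val n) = pi n) -> x g = a.
  have [[x xpi]|nx] := pselect (exists x, forall n : N, nuca s x (g * val n) = pi n).
    exists (x g) => y ypi; apply: det => n nN.
    by rewrite (xpi [` nN]%fset) (ypi [` nN]%fset).
  by exists (pi [` N1]%fset) => x xpi; case: nx; exists x.
have [f fE] := choice value.
exists [ffun pi => f pi] => x y xy; rewrite ffunE; symmetry; apply: fE => n.
by rewrite !ffunE shiftVE xy ?(valP n).
Qed.

(** Where the window avoids E the rule recovering x from sigma_c(x) also
    recovers it from sigma_s(x); hence t is constant outside E N^-1. *)
Lemma nuca_inverse s c (E N : {fset G}) : 1 \in N ->
  (forall g, g \notin E -> s g = c) ->
  (forall g, determines s g N) -> determines (fun=> c) 1 N ->
  exists (t : G -> local_rule N A) (d : local_rule N A) (E' : {fset G}),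
    (forall g, g \notin E' -> t g = d) /\ cancel (nuca s) (nuca t).
Proof.
move=> N1 sc det detc.
have [f fE] := choice (fun g => determines_recovers N1 (det g)).
have [d dE] := determines_recovers N1 detc.
pose E' := [fset e * n^-1 | e in E, n in N]%fset.
exists (fun g => if g \in E' then f g else d), d, E'; split=> [g /negPf -> //|x].
apply/funext => g; rewrite {1}/nuca; case: ifPn => gE; first exact: fE.
transitivity (shift g^-1 x 1); last by rewrite shiftVE mulg1.
rewrite -[RHS](dE _ (shift g^-1 (nuca s x))) ?invg1 ?shift1 // => n nN.
rewrite !mul1g shiftVE; apply: nuca_local => [|m _]; last by rewrite shiftVE mulgA.
apply: sc; apply: contra gE => gnE.
by apply/imfset2P; exists (g * n) => //; exists n; rewrite ?mulgK.
Qed.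

End Inverse.

(** * Stable invertibility *)

Section FarCancel.
Context {G : groupType} {A : finType} {M N : {fset G}}.
Implicit Types (s : G -> local_rule M A) (t : G -> local_rule N A).

Lemma shift_cancel s t g : cancel (nuca t) (nuca s) ->
  cancel (nuca (shift g t)) (nuca (shift g s)).
Proof. by move=> tK x; rewrite -[x](shiftVK g) !nuca_shift tK. Qed.

(** An identity between local rules is checked at one place h; translating s and t
    brings there a region where both are constant. *)
Lemma far_cancel s t (c : local_rule M A) (d : local_rule N A) (E E' : {fset G}) :
  (forall F : {fset G}, exists g, g \notin F) ->
  (forall g, g \notin E -> s g = c) -> (forall g, g \notin E' -> t g = d) ->
  cancel (nuca t) (nuca s) -> cancel (nuca (fun=> d)) (nuca (fun=> c)).
Proof.
move=> infG sc td tK x; apply/funext => h.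
have [g gE] := far_translate (h |` [fset h * m | m in M])%fset (E `|` E')%fset infG.
rewrite -[in RHS](shift_cancel g^-1 tK x).
apply: nuca_local => [|m mM].
  rewrite shiftVE sc //; have := gE h (fset1U1 _ _).
  by rewrite in_fsetU negb_or => /andP[].
apply: nuca_local => //; rewrite shiftVE td //.
have hm : h * m \in (h |` [fset h * m | m in M])%fset.
  by rewrite fset1Ur //; apply/imfsetP; exists m.
by have := gE _ hm; rewrite in_fsetU negb_or => /andP[].
Qed.

End FarCancel.

Section Stability.
Context {G : groupType} {A : finType} {M N : {fset G}}.
Implicit Types (s : G -> local_rule M A) (t : G -> local_rule N A).

(** If p is different from c at k, a translate of s agreeing with p at k has a
    defect there, which leaves finitely many translates; each of them differs
    from p somewhere, so none of them agrees with p on a large finite set, unless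
    p is itself a translate. *)
Lemma orbit_closure_perturbation s (c : local_rule M A) (E : {fset G}) p :
  (forall g, g \notin E -> s g = c) -> orbit_closure s p ->
  (exists g, p = shift g s) \/
  p = (fun=> c) /\ forall F : {fset G}, exists g, g \notin F.
Proof.
move=> sc /orbit_closureP agree.
have [orb|norb] := pselect (exists g, p = shift g s); [by left | right].
have differ g : exists h, p h <> shift g s h.
  apply: contrapT => nh; apply: norb; exists g; apply/funext => h.
  by apply: contrapT => ph; apply: nh; exists h.
split; last first.
  move=> F; apply: contrapT => nF; have [g gF] := agree F.
  have [h] := differ g; apply; apply: gF; apply: contrapT => hF.
  by apply: nF; exists h; apply/negP.
have [h hP] := choice differ.
apply/funext => k; apply: contrapT => pk.
pose B := [fset k * e^-1 | e in E]%fset.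
have [g gF] := agree (k |` [fset h b | b in B])%fset.
have sgk : p k = s (g^-1 * k) by rewrite gF ?fset1U1.
have gkE : g^-1 * k \in E.
  by apply: contrapT => /negP /sc eq_c; apply: pk; rewrite sgk.
have gB : g \in B.
  by apply/imfsetP; exists (g^-1 * k) => //; rewrite invMg invgK mulVKg.
by apply: (hP g); apply: gF; rewrite fset1Ur //; apply/imfsetP; exists g.
Qed.

Lemma inverse_stably_invertible s t c d (E E' : {fset G}) :
  (forall g, g \notin E -> s g = c) -> (forall g, g \notin E' -> t g = d) ->
  cancel (nuca s) (nuca t) -> cancel (nuca t) (nuca s) -> stably_invertible s.
Proof.
move=> sc td sK tK; exists N, t => p /(orbit_closure_perturbation sc).
move=> [[g ->]|[-> infG]].
  exists (shift g t); split.
    by apply/orbit_closureP => F; exists g.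
  by split; apply/funext => x /=; apply: shift_cancel.
exists (fun=> d); split; last first.
  split; apply/funext => x /=; first exact: (far_cancel infG sc td tK).
  exact: (far_cancel infG td sc sK).
apply/orbit_closureP => F; have [g gE] := far_translate F E' infG.
by exists g^-1 => h hF; rewrite shiftVE td // gE.
Qed.

End Stability.

Section StablyInvertible.
Context {G : groupType} {A : finType} {M : {fset G}}.
Implicit Types (s : G -> local_rule M A) (c : local_rule M A).

Lemma cancel_surjective (T : Type) (f h : T -> T) :
  cancel f h -> (forall y, exists x, f x = y) -> cancel h f.
Proof. by move=> fK surj_f y; have [x <-] := surj_f y; rewrite fK. Qed.

(** When F is all of G every configuration is a finite perturbation of every
    other, so the identity serves as the surjective map to compare with. *)
Lemma finite_group_stably_invertible s (F : {fset G}) :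
  (forall g, g \in F) -> injective (nuca s) -> stably_invertible s.
Proof.
move=> allF inj_s.
have [surj_s _] : (forall p, exists x, nuca s x = p) /\ injective (@id (G -> A)).
  apply: (finite_perturbation_bijective (E := F) _ inj_s) => [x g|p].
    by rewrite allF.
  by exists p.
have det g : determines s g F.
  move=> x y xy; suff /inj_s -> : nuca s x = nuca s y by [].
  by apply/funext => h; rewrite -[h](mulVKg g) xy ?allF.
have [t tE] := choice (fun g => determines_recovers (allF 1) (det g)).
have sK : cancel (nuca s) (nuca t) by move=> x; apply/funext => g; exact: tE.
apply: (inverse_stably_invertible (c := s 1) (d := t 1) (E := F) (E' := F) _ _ sK).
- by move=> g; rewrite allF.
- by move=> g; rewrite allF.
- exact: cancel_surjective sK surj_s.
Qed.

Lemma surjective_stably_invertible s c (E : {fset G}) :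
  (forall g, g \notin E -> s g = c) -> injective (nuca s) ->
  (forall p, exists x, nuca (fun=> c) x = p) -> stably_invertible s.
Proof.
move=> sc inj_s surj_c.
have [surj_s inj_c] :
    (forall p, exists x, nuca s x = p) /\ injective (nuca (fun=> c)).
  apply: (finite_perturbation_bijective (E := E) _ inj_s surj_c) => x g gE.
  by apply: nuca_local => //; rewrite sc.
have [N0 /(determines_sub (fsubsetUr [fset 1] N0)) det1] :=
  injective_determines 1 inj_c.
have [N [N0N detN]] := determines_perturbation sc inj_s det1.
have N1 : 1 \in N by rewrite (fsubsetP N0N) ?fset1U1.
have [t [d [E' [td sK]]]] := nuca_inverse N1 sc detN (determines_sub N0N det1).
apply: (inverse_stably_invertible sc td sK).
exact: cancel_surjective sK surj_s.
Qed.

End StablyInvertible.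

Theorem corollary1p3 (R : realType) (G : groupType) (M : {fset G}) (A : finType)
    (s : G -> local_rule M A) (c : local_rule M A) :
  asymptotic s (fun _ : G => c) ->
  injective (nuca s) ->
  (amenable R G -> stably_invertible s) /\
  (sofic R G /\ injective (nuca (fun _ : G => c)) -> stably_invertible s).
Proof.
move=> [E sc] inj_s; split=> [amG|[sofG inj_c]]; last first.
  exact: surjective_stably_invertible sc inj_s (sofic_surjunctive sofG inj_c).
have [[F allF]|nF] := pselect (exists F : {fset G}, forall g, g \in F).
  exact: finite_group_stably_invertible allF inj_s.
have infG (F : {fset G}) : exists g, g \notin F.
  apply: contrapT => ng; apply: nF; exists F => g.
  by apply: contrapT => /negP gF; apply: ng; exists g.
apply: (surjective_stably_invertible sc inj_s).
apply: (amenable_preinjective_surjective amG) => D x y xyD.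
exact: constant_preinjective infG sc inj_s xyD.
Qed.
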